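(* Let $d\in\mathbb{Q}$ be a non-square. (i) If $d$ is not a sum of two (rational) squares, then there is no weight-$2$ Hodge structure of dimension six having a polarization of discriminant $(1 \bmod (\mathbb{Q}^* )^2)$ and an endomorphism algebra containing $\mathbb{Q}(\sqrt d)$. (ii) Suppose that $d$ is a sum of two (rational) squares. Then there exists a one-dimensional family of polarized, six-dimensional weight-$2$ Hodge structures of $K3$ type, having the underlying quadratic space $(\mathbb{Q}^6,\operatorname{diag}(1,1,-1,-1,-1,-1))$ and real multiplication by $\mathbb{Q}(\sqrt d)$.
   Context: A (pure $\mathbb{Q}$-)Hodge structure of weight $2$ is a finite-dimensional $\mathbb{Q}$-vector space $T$ together with a decomposition $T_{\mathbb{C}}:=T\otimes_{\mathbb{Q}}\mathbb{C}=H^{0,2}\oplus H^{1,1}\oplus H^{2,0}$ such that $\overline{H^{m,n}}=H^{n,m}$. Its dimension is $\dim_{\mathbb{Q}}T$. Morphisms are $\mathbb{Q}$-linear maps whose complexification respects the decompositions, and the endomorphism algebra $\operatorname{End}(T)$ is the algebra of endomorphisms of $T$ as a Hodge structure. The Hodge structure is of $K3$ type if $\dim_{\mathbb{C}}H^{2,0}=1$. A polarization on $T$ is a non-degenerate symmetric bilinear form $\langle\cdot,\cdot\rangle:T\times T\to\mathbb{Q}$ whose $\mathbb{C}$-bilinear extension to $T_{\mathbb{C}}$ satisfies: $\langle x,y\rangle=0$ for all $x\in H^{m,n}$, $y\in H^{m',n'}$ with $m\neq n'$; and $\langle x,\overline{x}\rangle>0$ for every non-zero $x$ in $H^{2,0}$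 or $H^{0,2}$, while $\langle x,\overline{x}\rangle<0$ for every non-zero $x\in H^{1,1}$. A Hodge structure together with a polarization is called polarized; its underlying quadratic space is $(T,\langle\cdot,\cdot\rangle)$. The discriminant of the polarization is the class of its Gram determinant in $\mathbb{Q}^*/(\mathbb{Q}^* )^2$. The notation $(\mathbb{Q}^6,\operatorname{diag}(a_1,\dots,a_6))$ means $\mathbb{Q}^6$ with the bilinear form given by that diagonal matrix. A polarized weight-$2$ Hodge structure $T$ of $K3$ type has real multiplication if $\operatorname{End}(T)$ is a totally real field strictly containing $\mathbb{Q}$; it has real multiplication by $K$ if moreover $\operatorname{End}(T)\cong K$. On the fixed quadratic space in (ii), such a Hodge structure is determined by the isotropic line $H^{2,0}\subset\mathbb{C}^6$; a one-dimensional family is one in which this line varies with one complex parameter.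
   Formalization: In (i) the endomorphism algebra is assumed to be a field and −d not a square (otherwise false: Q^6 of type (1,1), form −I, d=3; or d=−1 with Q(i)-multiplication); in (ii) real multiplication holds for all parameters in a connected open set outside a countable set, which is unavoidable. *)

(* Defs.v *)
From HB Require Import structures.
From mathcomp Require Import all_boot all_order all_algebra.
From mathcomp Require Import complex.
From mathcomp Require Import all_classical all_reals all_analysis.

Set Implicit Arguments.
Unset Strict Implicit.
Unset Printing Implicit Defensive.

Import Order.TTheory GRing.Theory Num.Theory.
Import numFieldNormedType.Exports.

Local Open Scope classical_set_scope.
Local Open Scope ring_scope.

Definition rat_square (a : rat) : Prop := exists c : rat, a = c ^+ 2.

Definition rat_sum_two_squares (a : rat) : Prop :=
  exists b c : rat, a = b ^+ 2 + c ^+ 2.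

(* Equality of the classes of a and b in Q^* / (Q^* )^2. *)
Definition eq_mod_squares (a b : rat) : Prop :=
  [/\ a != 0, b != 0 & exists2 c : rat, c != 0 & a = c ^+ 2 * b].

(* Q[X] / (X^2 - d); this is the field Q(sqrt d) as soon as d is not a square
   in Q. *)
Notation Qsqrt d := {poly %/ 'X^2 - (d : rat)%:P}.

(* A Q-vector space of dimension n is given with a basis, i.e. as Q^n, whose
   complexification is C^n. Vectors are row vectors, and a subspace of C^n is
   represented by the row space of a square matrix, as in mxalgebra.
   [hpiece T p] is H^{p, 2-p}, so that [rev_ord] exchanges H^{m,n} and
   H^{n,m}. *)
Record hodge2 (C : numClosedFieldType) (n : nat) := Hodge2 {
  hpiece : 'I_3 -> 'M[C]_n;
  hpiece_full : (\sum_p hpiece p == 1%:M)%MS;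
  hpiece_direct : mxdirect (\sum_p hpiece p)%MS;
  hpiece_conj : forall p, (map_mx Num.conj (hpiece p) == hpiece (rev_ord p))%MS
}.

Section Hodge.
Variables (C : numClosedFieldType) (n : nat).
Implicit Types (T : hodge2 C n) (S M : 'M[rat]_n).

Definition H02 T := hpiece T (0 : 'I_3).
Definition H11 T := hpiece T (1 : 'I_3).
Definition H20 T := hpiece T (2 : 'I_3).

Definition K3_type T : Prop := \rank (H20 T) = 1%N.

(* The C-bilinear extension to C^n of the form on Q^n with Gram matrix S. *)
Definition Cform S (x y : 'rV[C]_n) : C := (x *m map_mx ratr S *m y^T) 0 0.

Record polarization T S : Prop := Polarization {
  pol_sym : S^T = S;
  pol_nondeg : S \in unitmx;
  pol_orth : forall (p q : 'I_3) (x y : 'rV[C]_n),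
    (x <= hpiece T p)%MS -> (y <= hpiece T q)%MS -> p != rev_ord q ->
    Cform S x y = 0;
  pol_pos : forall x : 'rV[C]_n, (x <= H20 T)%MS || (x <= H02 T)%MS ->
    x != 0 -> 0 < Cform S x (map_mx Num.conj x);
  pol_neg : forall x : 'rV[C]_n, (x <= H11 T)%MS ->
    x != 0 -> Cform S x (map_mx Num.conj x) < 0
}.

(* M acts by v |-> v *m M, so the product of matrices is composition in
   diagrammatic order. *)
Definition hodge_endo T : pred 'M[rat]_n :=
  fun M => [forall p, stablemx (hpiece T p) (map_mx ratr M)].

Fact hodge_endo_subring T : subring_closed (hodge_endo T).
Proof.
split=> [|M N /forallP hM /forallP hN|M N /forallP hM /forallP hN];
  apply/forallP => p.
- by rewrite map_mx1 mulmx1.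
- by rewrite map_mxB mulmxBr addmx_sub ?eqmx_opp ?hM ?hN.
- by rewrite map_mxM mulmxA (submx_trans (submxMr _ (hM p))) ?hN.
Qed.

HB.instance Definition _ T :=
  GRing.isSubringClosed.Build 'M[rat]_n (hodge_endo T) (hodge_endo_subring T).

Record hodge_End T := HodgeEnd {
  hodge_End_mx :> 'M[rat]_n;
  _ : hodge_End_mx \in hodge_endo T
}.

HB.instance Definition _ T := [isSub for @hodge_End_mx T].
HB.instance Definition _ T := [Choice of hodge_End T by <:].
HB.instance Definition _ T := GRing.SubChoice_isSubPzRing.Build _ _
  (hodge_End T) (hodge_endo_subring T).

Definition is_field (E : pzRingType) : Prop :=
  [/\ 1 != 0 :> E, commutative (@GRing.mul E)
    & forall x : E, x != 0 -> exists y : E, x * y = 1].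

Definition totally_real (E : pzRingType) : Prop :=
  forall (f : {rmorphism E -> C}) (x : E), f x \is Num.real.

Definition End_contains (K : pzRingType) T : Prop :=
  exists f : {rmorphism K -> hodge_End T}, injective f.

Definition real_mult T S : Prop :=
  [/\ polarization T S, K3_type T, is_field (hodge_End T),
      totally_real (hodge_End T)
    & exists M : hodge_End T, forall a : rat, hodge_End_mx M <> a%:M].

Definition real_mult_by (K : pzRingType) T S : Prop :=
  real_mult T S /\ exists f : {rmorphism K -> hodge_End T}, bijective f.

End Hodge.

(* t |-> C * omega t is a holomorphic family of lines in C^n, parametrized by
   the connected open subset U of C and with pairwise distinct members. *)
Record line_family (C : numFieldType) (n : nat) (U : set C)
    (omega : C -> 'rV[C]_n) : Prop := LineFamily {
  lf_open : open U;
  lf_nonempty : U !=set0;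
  lf_connected : connected U;
  lf_neq0 : forall t, U t -> omega t != 0;
  lf_holo : forall t, U t -> forall i,
    derivable (fun s : C^o => omega s 0 i : C^o) t 1;
  lf_inj : forall s t, U s -> U t -> (omega s == omega t)%MS -> s = t
}.

(* diag(1, 1, -1, -1, -1, -1) *)
Definition form24 : 'M[rat]_6 :=
  diag_mx (\row_(i < 6) if (i < 2)%N then 1 else -1).

(* Main.v *)
From HB Require Import structures.
From mathcomp Require Import all_boot all_order all_algebra.
From mathcomp Require Import complex ring lra.
From mathcomp Require Import all_classical all_reals all_analysis.
Require Import Defs.

Set Implicit Arguments.
Unset Strict Implicit.
Unset Printing Implicit Defensive.

Import Order.TTheory GRing.Theory Num.Theory.
Import numFieldNormedType.Exports.

Local Open Scope ring_scope.

(** (i) Let [A] be the endomorphism [sqrt d]. Its adjoint for the polarization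
    is again a Hodge endomorphism with square [d], so [A* = A] or [A* = - A]
    since the endomorphism algebra is a field. Splitting off the planes
    [<v, v A>] orthogonally writes the discriminant, up to squares, as a product
    of three Gram determinants [d a^2 - b^2], hence as minus a norm from
    [Q(sqrt d)], if [A* = A], and as [(- d)^3] if [A* = - A]. If the
    discriminant is 1, then in the first case -1 is a norm, so that [d] is a sum
    of two squares, and in the second case [- d] is a square.

    (ii) If [d = b^2 + c^2], then [diag(1, -1)], [diag(1, -1)] and
    [diag(-1, -1)] all have a self-adjoint square root of [d]. The
    [sqrt d]-eigenspace of their sum has signature (2, 1), so that the isotropic
    lines in its complexification form a conic on which the period varies. A
    rational matrix [M] outside [Q(sqrt d)] is an endomorphism for finitely many
    periods only: [M] has finitely many eigenvalues [lam], and
    [omega(t) (M - lam) = 0] is a nontrivial quadratic equation in [t]. There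
    are countably many [M]. *)

Local Notation conjv := (map_mx Num.conj).

(** * Symmetric bilinear forms with a square root of [d] *)

Lemma form_delta (R : comPzRingType) n (S : 'M[R]_n) i j :
  ((delta_mx 0 i : 'rV_n) *m S *m (delta_mx 0 j : 'rV_n)^T) 0 0 = S i j.
Proof. by rewrite -rowE trmx_delta -colE !mxE. Qed.

Lemma mx11D (R : pzRingType) (X Y : 'M[R]_1) : (X + Y) 0 0 = X 0 0 + Y 0 0.
Proof. by rewrite mxE. Qed.

(** If two isotropic basis vectors pair to [S i j != 0], their sum has the value [2 * S i j], which
    is non-zero in characteristic 0. *)
Lemma sym_form_neq0_vector n (S : 'M[rat]_n) :
  S^T = S -> S != 0 -> exists v : 'rV_n, (v *m S *m v^T) 0 0 != 0.
Proof.
move=> Ssym /matrix0Pn[i [j Sij]].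
have Sji : S j i = S i j by rewrite -{1}Ssym mxE.
have [Sii|Sii] := eqVneq (S i i) 0; last first.
  by exists (delta_mx 0 i); rewrite form_delta.
have [Sjj|Sjj] := eqVneq (S j j) 0; last first.
  by exists (delta_mx 0 j); rewrite form_delta.
exists (delta_mx 0 i + delta_mx 0 j).
rewrite linearD /= !mulmxDl !mulmxDr !mx11D !form_delta Sii Sjj Sji.
by rewrite add0r addr0 -mulr2n mulrn_eq0.
Qed.

(** In the rank factorization of [U], the column factor is enlarged by an identity block; the row
    factor is already invertible. *)
Lemma row_free_complete (F : fieldType) m n (U : 'M[F]_(m, m + n)) :
  row_free U -> exists2 P : 'M[F]_(m + n), P \in unitmx & usubmx P = U.
Proof.
move=> /eqP rU; exists (block_mx (col_ebase U) 0 0 1%:M *m row_ebase U).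
  rewrite unitmx_mul row_ebase_unit andbT unitmxE det_ublock det1 mulr1.
  by rewrite -unitmxE col_ebase_unit.
rewrite -[U in RHS]mulmx_ebase rU /block_mx mul_col_mx col_mxKu.
have -> : pid_mx m = row_mx 1%:M 0 :> 'M[F]_(m, m + n) by rewrite pid_mx_row.
by rewrite mul_mx_row mulmx1 mulmx0.
Qed.

Lemma det_mx2 (R : comPzRingType) (M : 'M[R]_(1 + 1)) :
  let l := lshift 1 (0 : 'I_1) in let r := rshift 1 (0 : 'I_1) in
  \det M = M l l * M r r - M l r * M r l.
Proof.
rewrite /= (expand_det_row _ (lshift 1 0)) big_split_ord !big_ord1.
rewrite /cofactor !det_mx11 !mxE /= expr0 mul1r mulN1r mulrN.
by congr (_ * M _ _ - _ * M _ _); apply: val_inj.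
Qed.

(* The pairs [(a, b)] in [l] are [(<v, v>, <v, v A>)] for generators [v] of the
   successive planes that are split off; [e = 1] is the self-adjoint case and
   [e = -1] the skew-adjoint one, where [b = 0]. *)
Lemma det_sqrt_adjoint (d e : rat) k (S A : 'M[rat]_(k.*2)) :
    ~ rat_square d -> e = 1 \/ e = -1 ->
    S^T = S -> S \in unitmx -> A *m A = d%:M -> A *m S = e *: (S *m A^T) ->
  exists (l : seq (rat * rat)) (c : rat),
    [/\ size l = k, c != 0, all (fun ab => (ab.1 != 0) && (ab.2 == e * ab.2)) l
      & \det S * c ^+ 2 = \prod_(ab <- l) (e * d * ab.1 ^+ 2 - ab.2 ^+ 2)].
Proof.
move=> dN eP; elim: k S A => [|k IH] S A Ssym Sunit AA AS.
  exists [::], 1; split=> //.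
  by rewrite big_nil expr1n mulr1 det_mx00.
move: S A Ssym Sunit AA AS.
change (k.+1.*2) with (2 + k.*2)%N; set n := k.*2 => S A Ssym Sunit AA AS.
have S0 : S != 0.
  by apply: contraTneq Sunit => ->; rewrite unitmxE det0 unitr0.
have [v] := sym_form_neq0_vector Ssym S0.
set a := (v *m S *m v^T) 0 0 => a0.
have vS : v *m S *m v^T = a%:M by rewrite [LHS]mx11_scalar.
set b := (v *m S *m (v *m A)^T) 0 0.
have vSA : v *m S *m (v *m A)^T = b%:M by rewrite [LHS]mx11_scalar.
have vAS : (v *m A) *m S *m v^T = (e * b)%:M.
  rewrite -(mulmxA v) AS -scalemxAr -scalemxAl mulmxA.
  by rewrite -(mulmxA _ A^T) -trmx_mul vSA scale_scalar_mx.
have be : b = e * b.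
  have /(congr1 (fun M : 'M[rat]_1 => M 0 0)) := vAS.
  rewrite -[v *m A *m S *m v^T]trmxK mxE !trmx_mul trmxK Ssym mulmxA.
  by rewrite -trmx_mul vSA !mxE /= !mulr1n.
have vASA : (v *m A) *m S *m (v *m A)^T = (e * d * a)%:M.
  rewrite -(mulmxA v) AS -scalemxAr -scalemxAl mulmxA.
  rewrite trmx_mul -(mulmxA _ A^T) (mulmxA A^T) -trmx_mul AA tr_scalar_mx.
  by rewrite mul_scalar_mx -scalemxAr vS !scale_scalar_mx mulrA.
set U : 'M[rat]_(1 + 1, 2 + n) := col_mx v (v *m A).
set G := (block_mx a%:M b%:M b%:M (e * d * a)%:M : 'M[rat]_(1 + 1)).
have UG : U *m S *m U^T = G.
  rewrite /U mul_col_mx tr_col_mx mul_col_mx !mul_mx_row vS vSA vAS vASA.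
  by rewrite -be.
have detG : \det G = e * d * a ^+ 2 - b ^+ 2.
  by rewrite det_mx2 block_mxEul block_mxEur block_mxEdl block_mxEdr !mxE /=; ring.
(* A degenerate plane would give [d = (b / a)^2] if [e = 1]; if [e = -1], then [b = 0] and hence
   [d = 0]. Either way [d] would be a square. *)
have dG : e * d * a ^+ 2 - b ^+ 2 != 0.
  apply/eqP => G0; apply: dN.
  case: eP be G0 => -> be G0.
    exists (b / a); rewrite expr_div_n; apply: (mulIf (expf_neq0 2 a0)).
    rewrite mulfVK ?expf_neq0 //; apply/eqP; rewrite -subr_eq0 -G0.
    by rewrite mul1r.
  have b0 : b = 0 by lra.
  exists 0; move/eqP: G0; rewrite b0 !expr0n subr0 mulN1r mulNr oppr_eq0.
  by rewrite mulf_eq0 (negPf (expf_neq0 2 a0)) orbF => /eqP.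
have Gunit : G \in unitmx by rewrite unitmxE unitfE detG.
have Ufree : row_free U.
  rewrite /row_free eqn_leq rank_leq_row /=.
  have /leq_trans -> // : (1 + 1 <= \rank G)%N by rewrite (mxrank_unit Gunit).
  by rewrite -UG -mulmxA mxrankM_maxl.
have [P Punit PU] := row_free_complete Ufree.
(* The complementary rows of [P], minus their orthogonal projections to the plane [U]. *)
set V := dsubmx P - dsubmx P *m S *m U^T *m invmx G *m U.
have VSU : V *m S *m U^T = 0.
  by rewrite !mulmxBl -!mulmxA (mulmxA U) UG mulVmx // mulmx1 subrr.
have USV : U *m S *m V^T = 0.
  by apply: trmx_inj; rewrite !trmx_mul trmxK Ssym mulmxA VSU trmx0.
set Q := col_mx U V.
have Qunit : Q \in unitmx.
  suff -> : Q = block_mx 1%:M 0 (- (dsubmx P *m S *m U^T *m invmx G)) 1%:M *m P.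
    by rewrite unitmx_mul Punit andbT unitmxE det_lblock !det1 mulr1 unitr1.
  rewrite -[P in RHS]vsubmxK PU mul_block_col !mul1mx mul0mx addr0 mulNmx.
  by congr col_mx; rewrite col_mxKd; exact: addrC.
set D := V *m S *m V^T.
have QSQ : Q *m S *m Q^T = block_mx G 0 0 D.
  by rewrite mul_col_mx tr_col_mx mul_col_mx !mul_mx_row UG VSU USV block_mxEv.
(* [B] is [A] in the basis [Q]. As [A] preserves the plane [U], its upper right block is 0. *)
set B := Q *m A *m invmx Q.
have BQ : B *m Q = Q *m A by rewrite mulmxKV.
clearbody B.
pose J := (block_mx 0 1%:M d%:M 0 : 'M[rat]_(1 + 1)).
have UA : U *m A = J *m U.
  rewrite /U mul_col_mx -(mulmxA v) AA mul_block_col !mul0mx mul1mx add0r addr0.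
  by rewrite mul_mx_scalar mul_scalar_mx.
have Bu : usubmx B = row_mx J 0.
  apply: (can_inj (mulmxK Qunit)).
  by rewrite mul_usub_mx BQ mul_col_mx col_mxKu UA mul_row_col mul0mx addr0.
have BB : B *m B = d%:M.
  apply: (can_inj (mulmxK Qunit)).
  by rewrite -mulmxA BQ mulmxA BQ -mulmxA AA mul_mx_scalar mul_scalar_mx.
have BS : B *m (block_mx G 0 0 D) = e *: (block_mx G 0 0 D *m B^T).
  rewrite -QSQ -!mulmxA -trmx_mul BQ !mulmxA BQ trmx_mul.
  rewrite -(mulmxA Q A) AS -scalemxAr -scalemxAl. by rewrite !mulmxA.
have B12 : ursubmx B = 0 by rewrite /ursubmx Bu row_mxKr.
have Bb := submxK B.
(* The lower left block of [BS] reads [B21 G = 0], so [B] is block diagonal and its last block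
   inherits all hypotheses on the orthogonal complement. *)
move: BS BB; rewrite -Bb B12 tr_block_mx trmx0 !mulmx_block.
rewrite !(mulmx0, mul0mx, add0r, addr0) scale_block_mx scaler0 (scalar_mx_block _ _ d).
move=> /eq_block_mx[_ _ /(congr1 (mulmxr (invmx G)))] /=.
rewrite mul0mx mulmxK // => B21 BD.
rewrite B21 mul0mx add0r => /eq_block_mx[_ _ _ BB].
have detS : \det S * (\det Q) ^+ 2 = \det G * \det D.
  by rewrite -(det_ublock _ 0) -QSQ !det_mulmx det_tr; ring.
have Dunit : D \in unitmx.
  rewrite unitmxE unitfE; apply: contraTneq Sunit => D0.
  move/eqP: detS; rewrite D0 mulr0 mulf_eq0 expf_eq0 /= unitmxE unitfE => /orP[->//|].
  by move: Qunit; rewrite unitmxE unitfE => /negPf ->.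
have Dsym : D^T = D by rewrite !trmx_mul trmxK Ssym mulmxA.
have [l [c [sl c0 al lP]]] := IH D _ Dsym Dunit BB BD.
exists ((a, b) :: l), (c * \det Q); split => /=.
- by rewrite sl.
- by rewrite mulf_neq0 // -unitfE -unitmxE.
- by rewrite a0 -be eqxx.
- by rewrite big_cons -lP -detG exprMn mulrA mulrAC detS; ring.
Qed.

(** * Hodge endomorphisms and adjoints *)

Section Form.
Variables (C : numClosedFieldType) (n : nat) (S : 'M[rat]_n).
Implicit Types x y : 'rV[C]_n.

Lemma CformDl (x y z : 'rV[C]_n) : Cform S (x + y) z = Cform S x z + Cform S y z.
Proof. by rewrite /Cform !mulmxDl mxE. Qed.

Lemma Cform_suml I (r : seq I) (P : pred I) (F : I -> 'rV[C]_n) z :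
  Cform S (\sum_(i <- r | P i) F i) z = \sum_(i <- r | P i) Cform S (F i) z.
Proof. by rewrite /Cform !mulmx_suml summxE. Qed.

Lemma Cform_sumr I (r : seq I) (P : pred I) (F : I -> 'rV[C]_n) z :
  Cform S z (\sum_(i <- r | P i) F i) = \sum_(i <- r | P i) Cform S z (F i).
Proof. by rewrite /Cform linear_sum mulmx_sumr summxE. Qed.

Lemma CformDr x y z : Cform S z (x + y) = Cform S z x + Cform S z y.
Proof. by rewrite /Cform linearD /= mulmxDr mxE. Qed.

Lemma CformZl a x y : Cform S (a *: x) y = a * Cform S x y.
Proof. by rewrite /Cform -!scalemxAl mxE. Qed.

Lemma CformZr a x y : Cform S x (a *: y) = a * Cform S x y.
Proof. by rewrite /Cform linearZ /= -scalemxAr mxE. Qed.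

Lemma Cform0l y : Cform S 0 y = 0.
Proof. by rewrite /Cform !mul0mx mxE. Qed.

Lemma map_conj_ratr m k (M : 'M[rat]_(m, k)) :
  conjv (map_mx (@ratr C) M) = map_mx ratr M.
Proof. by apply/matrixP=> i j; rewrite !mxE fmorph_rat. Qed.

Lemma conjvK m k : involutive (fun M : 'M[C]_(m, k) => conjv M).
Proof. by move=> M; apply/matrixP=> i j; rewrite !mxE conjCK. Qed.

Lemma Cform_conj x y : Cform S (conjv x) (conjv y) = (Cform S x y)^*.
Proof.
transitivity (conjv (x *m map_mx ratr S *m y^T) 0 0); last by rewrite mxE.
by rewrite !map_mxM map_conj_ratr /Cform map_trmx.
Qed.

Hypothesis Ssym : S^T = S.

Lemma CformC x y : Cform S x y = Cform S y x.
Proof.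
rewrite /Cform; transitivity ((x *m map_mx ratr S *m y^T)^T 0 0).
  by rewrite [in RHS]mxE.
by rewrite !trmx_mul trmxK map_trmx Ssym mulmxA.
Qed.

End Form.

(** Multiplicativity of the norm turns the product of three factors [d a^2 - b^2] into a single
    [d y^2 - x^2]. This equals a non-zero square, so [d y^2] is a sum of two squares with
    [y != 0]. *)
Lemma self_adjoint_sqrt_sum_two_squares (d : rat) (S A : 'M[rat]_6) :
    ~ rat_square d -> S^T = S -> eq_mod_squares (\det S) 1 ->
    A *m A = d%:M -> A *m S = S *m A^T -> rat_sum_two_squares d.
Proof.
move=> dN Ssym [S0 _ [m m0 Sm]] AA AS.
have Sunit : S \in unitmx by rewrite unitmxE unitfE.
have AS1 : A *m S = 1 *: (S *m A^T) by rewrite scale1r.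
have [l [c [sl c0 _]]] := det_sqrt_adjoint (k := 3) dN (or_introl erefl) Ssym Sunit AA AS1.
case: l sl => [|[a1 b1] [|[a2 b2] [|[a3 b3] []]]] // _.
rewrite !big_cons big_nil Sm mulr1 -exprMn /=.
(* [x + y sqrt d] is the product of the three [b_i + a_i sqrt d]. *)
set x := (b1 * b2 + d * a1 * a2) * b3 + d * (a1 * b2 + a2 * b1) * a3.
set y := (b1 * b2 + d * a1 * a2) * a3 + (a1 * b2 + a2 * b1) * b3.
move=> E; have {}E : d * y ^+ 2 = x ^+ 2 + (m * c) ^+ 2 by rewrite E /x /y; ring.
have mc : m * c != 0 by rewrite mulf_neq0.
have y0 : y != 0.
  apply: contra_neq mc => y0; move/esym/eqP: E.
  by rewrite y0 expr0n mulr0 paddr_eq0 ?sqr_ge0 // !sqrf_eq0 => /andP[_ /eqP].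
exists (x / y), (m * c / y).
by rewrite !expr_div_n -mulrDl -E mulfK // sqrf_eq0.
Qed.

(** Here every [b_i] is 0, so the non-zero square [(m c)^2] equals [(- d)^3 (a1 a2 a3)^2]. The
    number of planes being odd, [- d] is itself a square. *)
Lemma skew_adjoint_sqrt_opp_square (d : rat) (S A : 'M[rat]_6) :
    ~ rat_square d -> S^T = S -> eq_mod_squares (\det S) 1 ->
    A *m A = d%:M -> A *m S = - (S *m A^T) -> rat_square (- d).
Proof.
move=> dN Ssym [S0 _ [m m0 Sm]] AA AS.
have Sunit : S \in unitmx by rewrite unitmxE unitfE.
have AS1 : A *m S = -1 *: (S *m A^T) by rewrite scaleN1r.
have [l [c [sl c0]]] := det_sqrt_adjoint (k := 3) dN (or_intror erefl) Ssym Sunit AA AS1.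
case: l sl => [|[a1 b1] [|[a2 b2] [|[a3 b3] []]]] //= _.
have opp0 (b : rat) : b == -1 * b -> b = 0 by move=> /eqP; lra.
case/and4P=> /andP[a10 /opp0->] /andP[a20 /opp0->] /andP[a30 /opp0->] _.
rewrite !big_cons big_nil Sm mulr1 -exprMn /= => E.
have d0 : d != 0 by apply/eqP => d0; apply: dN; exists 0; rewrite d0 expr0n.
exists (m * c / (d * (a1 * a2 * a3))).
by rewrite expr_div_n E; field; rewrite a10 a20 a30 d0.
Qed.

Lemma hodge_EndB (C : numClosedFieldType) n (T : hodge2 C n) (x y : hodge_End T) :
  hodge_End_mx (x - y) = hodge_End_mx x - hodge_End_mx y.
Proof. exact: (rmorphB (val : hodge_End T -> _)). Qed.

Lemma hodge_EndM (C : numClosedFieldType) n (T : hodge2 C n) (x y : hodge_End T) :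
  hodge_End_mx (x * y) = hodge_End_mx x *m hodge_End_mx y.
Proof. exact: (rmorphM (val : hodge_End T -> _)). Qed.

Lemma hodge_End1 (C : numClosedFieldType) n (T : hodge2 C n) :
  hodge_End_mx (1 : hodge_End T) = 1%:M.
Proof. exact: (rmorph1 (val : hodge_End T -> _)). Qed.

Lemma hodge_EndD (C : numClosedFieldType) n (T : hodge2 C n) (x y : hodge_End T) :
  hodge_End_mx (x + y) = hodge_End_mx x + hodge_End_mx y.
Proof. exact: (rmorphD (val : hodge_End T -> _)). Qed.

Section Adjoint.
Variables (C : numClosedFieldType) (n : nat) (T : hodge2 C n) (S : 'M[rat]_n).
Hypothesis pol : polarization T S.

Lemma hpiece_decomp (x : 'rV[C]_n) :
  exists2 z : 'I_3 -> 'rV[C]_n, forall p, (z p <= hpiece T p)%MS &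
                                          x = \sum_p z p.
Proof.
have : (x <= \sum_p hpiece T p)%MS by rewrite (eqmxP (hpiece_full T)) submx1.
by case/sub_sumsmxP=> u ->; exists (fun p => u p *m hpiece T p) => // p;
  rewrite submxMl.
Qed.

Lemma Cform_nondeg (x : 'rV[C]_n) : (forall y, Cform S x y = 0) -> x = 0.
Proof.
move=> x0; have Sunit : map_mx ratr S \in @unitmx C n.
  by rewrite map_unitmx (pol_nondeg pol).
apply: (can_inj (mulmxK Sunit)); rewrite mul0mx.
by apply/rowP=> j; have := x0 (delta_mx 0 j); rewrite /Cform trmx_delta -colE !mxE.
Qed.

(** For [q != p], the component of [x] in piece [q] can only pair with piece [rev_ord q]. There it
    pairs as [x] does, that is to 0, so it vanishes by nondegeneracy. *)
Lemma hpiece_ortho p (x : 'rV[C]_n) :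
  (forall q y, q != rev_ord p -> (y <= hpiece T q)%MS -> Cform S x y = 0) ->
  (x <= hpiece T p)%MS.
Proof.
move=> xo; have [z zT xE] := hpiece_decomp x.
suff z0 q : q != p -> z q = 0.
  by rewrite xE (bigD1 p) //= big1 ?addr0 // => q /z0.
move=> qp; apply: Cform_nondeg => y; have [w wT ->] := hpiece_decomp y.
rewrite Cform_sumr big1 // => r _.
have [rq|rq] := eqVneq q (rev_ord r); last exact: (pol_orth pol (zT q) (wT r)).
rewrite -[RHS](xo r (w r) _ (wT r)); last first.
  by apply: contra_neq qp => rp; rewrite rq rp rev_ordK.
rewrite xE Cform_suml (bigD1 q) //= big1 ?addr0 // => s sq.
by apply: (pol_orth pol (zT s) (wT r)); rewrite -rq.
Qed.

Definition adjoint (A : 'M[rat]_n) := S *m A^T *m invmx S.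

Lemma Cform_adjoint A (x y : 'rV[C]_n) :
  Cform S (x *m map_mx ratr (adjoint A)) y = Cform S x (y *m map_mx ratr A).
Proof.
rewrite /Cform trmx_mul map_trmx !mulmxA -(mulmxA x) -map_mxM /adjoint.
by rewrite mulmxKV ?(pol_nondeg pol) // map_mxM !mulmxA.
Qed.

(** Each piece is cut out by orthogonality relations to other pieces, and these are stable under
    [A]. *)
Lemma adjoint_hodge_endo A : A \in hodge_endo T -> adjoint A \in hodge_endo T.
Proof.
move=> /forallP AT; apply/forallP => p; apply/row_subP => i; rewrite row_mul.
apply: hpiece_ortho => q y qp yT; rewrite Cform_adjoint.
apply: (pol_orth pol (row_sub i _) (submx_trans (submxMr _ yT) (AT q))).
by apply: contra_neq qp => ->; rewrite rev_ordK.
Qed.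

(** The adjoint is a second square root of [d] in the field [hodge_End T], so [(a + b) (a - b) = 0]
    there. *)
Lemma adjoint_sqrt A d :
    is_field (hodge_End T) -> A \in hodge_endo T -> A *m A = d%:M ->
  A *m S = S *m A^T \/ A *m S = - (S *m A^T).
Proof.
case=> _ Ecomm Einv AT AA.
have Sunit := pol_nondeg pol.
have BB : adjoint A *m adjoint A = d%:M.
  rewrite /adjoint !mulmxA mulmxKV // -(mulmxA S) -trmx_mul AA tr_scalar_mx.
  by rewrite mul_mx_scalar -scalemxAl mulmxV // scalemx1.
pose a : hodge_End T := HodgeEnd AT.
pose b : hodge_End T := HodgeEnd (adjoint_hodge_endo AT).
have sqr : a * a = b * b by apply: val_inj => /=; rewrite -![_ * _]/(_ *m _) AA BB.
have ab0 : (a + b) * (a - b) = 0.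
  by rewrite mulrDl !mulrBr (Ecomm b a) sqr addrC subrKA subrr.
have [/eqP|ab] := eqVneq (a + b) 0.
  rewrite addr_eq0 => /eqP/(congr1 (@hodge_End_mx _ _ _))/= AB; right.
  by rewrite {1}AB /adjoint mulNmx mulmxKV.
left; have [c] := Einv _ ab.
rewrite Ecomm => abc; have : a - b = 0.
  by rewrite -[_ - _]mul1r -abc -mulrA ab0 mulr0.
move=> /subr0_eq/(congr1 (@hodge_End_mx _ _ _))/= AB.
by rewrite {1}AB /adjoint mulmxKV.
Qed.
End Adjoint.

(** Stability of [H20] suffices: [H02] follows by conjugation because [A] is rational, and [H11]
    because it is the orthogonal complement of the other two pieces and [A] is self-adjoint. *)
Lemma hodge_endo_self_adjoint (C : numClosedFieldType) n (T : hodge2 C n) S A lam :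
    polarization T S -> A *m S = S *m A^T ->
    H20 T *m map_mx ratr A = lam *: H20 T ->
  A \in hodge_endo T.
Proof.
move=> pol AS A20.
have st2 : stablemx (H20 T) (map_mx ratr A) by rewrite A20 scalemx_sub.
have st0 : stablemx (H02 T) (map_mx ratr A).
  have e : (conjv (H20 T) == H02 T)%MS.
    by have := hpiece_conj T 2; have -> : rev_ord 2 = 0 :> 'I_3 by apply: val_inj.
  rewrite -(eqmxMr _ (eqmxP e)) -(eqmxP e) -(map_conj_ratr C A) -map_mxM.
  by rewrite A20 map_mxZ scalemx_sub.
have adj (x y : 'rV[C]_n) :
    Cform S (x *m map_mx ratr A) y = Cform S x (y *m map_mx ratr A).
  by rewrite /Cform trmx_mul map_trmx -!mulmxA (mulmxA _ (map_mx ratr S)) -map_mxM AS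
     map_mxM !mulmxA.
apply/forallP => -[[|[|[|//]]] pP].
- by have -> : Ordinal pP = 0 :> 'I_3 by apply: val_inj.
- have -> : Ordinal pP = 1 :> 'I_3 by apply: val_inj.
  apply/row_subP => i; rewrite row_mul; apply: (hpiece_ortho pol) => q y q1 yT.
  rewrite adj; apply: (pol_orth pol (row_sub i _) (_ : is_true (_ <= hpiece T q)%MS)).
    case: q q1 yT => [[|[|[|//]]] qP] q1 yT; apply: submx_trans (submxMr _ yT) _.
    + by have -> : Ordinal qP = 0 :> 'I_3 by apply: val_inj.
    + by case/eqP: q1; apply: val_inj.
    + by have -> : Ordinal qP = 2 :> 'I_3 by apply: val_inj.
  by apply: contra_neq q1 => ->; rewrite rev_ordK.
- by have -> : Ordinal pP = 2 :> 'I_3 by apply: val_inj.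
Qed.

(** Quotient rings [{poly %/ h}] reduce modulo [mk_monic h], which differs from [h] unless [h] is
    monic and non-constant. *)
Lemma Qsqrt_monic (d : rat) : mk_monic ('X^2 - d%:P) = 'X^2 - d%:P.
Proof.
by rewrite /mk_monic size_XnsubC // monicXnsubC.
Qed.

Lemma hodge_End_sqrt (C : numClosedFieldType) (n : nat) (T : hodge2 C n) d :
  End_contains (Qsqrt d) T -> exists2 A, A \in hodge_endo T & A *m A = d%:M.
Proof.
case=> f finj; pose h : {poly rat} := 'X^2 - d%:P.
pose x : {poly %/ h} := in_qpoly h 'X.
exists (hodge_End_mx (f x)); first by case: (f x).
(* The morphism [f] is only a ring morphism; on constants, additivity already implies
   [rat]-linearity, so [d] goes to [d%:M]. *)
pose g (a : rat^o) : 'M[rat]_n := hodge_End_mx (f (qpolyC h a)).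
have gB : zmod_morphism g by move=> a b; rewrite /g !rmorphB hodge_EndB.
have -> : d%:M = g d.
  rewrite -[d in RHS]mulr1 -[d * 1]/(d *: (1 : rat^o)) (rat_linear gB).
  by rewrite /g !rmorph1 hodge_End1 scalemx1.
rewrite -hodge_EndM -rmorphM; congr (hodge_End_mx (f _)).
rewrite /x -in_qpolyM -expr2.
apply: val_inj => /=; rewrite Qsqrt_monic.
have {1}-> : 'X^2 = 1 * h + d%:P by rewrite mul1r subrK.
rewrite Pdiv.RingMonic.rmodp_addl_mul_small ?monicXnsubC //.
by rewrite size_XnsubC // ltnS (leq_trans (size_polyC_leq1 _)).
Qed.

Lemma no_hodge_sqrt_mult (C : numClosedFieldType) (T : hodge2 C 6) S (d : rat) :
    ~ rat_square d -> polarization T S -> eq_mod_squares (\det S) 1 ->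
    is_field (hodge_End T) -> End_contains (Qsqrt d) T ->
  rat_square (- d) \/ rat_sum_two_squares d.
Proof.
move=> dN pol S1 Efield /hodge_End_sqrt[A AT AA]; have Ssym := pol_sym pol.
have [AS|AS] := adjoint_sqrt pol Efield AT AA.
  by right; apply: self_adjoint_sqrt_sum_two_squares AS.
by left; apply: skew_adjoint_sqrt_opp_square AS.
Qed.

(** * The Hodge structure of a positive isotropic line *)

Lemma form24_sym : form24^T = form24.
Proof. by rewrite /form24 tr_diag_mx. Qed.

Lemma form24_unit : form24 \in unitmx.
Proof.
rewrite unitmxE unitfE det_diag; apply/prodf_neq0 => i _; rewrite mxE.
by case: ifP.
Qed.

Lemma Cform24E (C : numClosedFieldType) (x y : 'rV[C]_6) :
  Cform form24 x y = \sum_(i < 6) (if (i < 2)%N then 1 else -1) * x 0 i * y 0 i.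
Proof.
rewrite /Cform /form24 map_diag_mx mul_mx_diag mxE; apply: eq_bigr => i _.
rewrite !mxE [x 0 i * _]mulrC.
by case: ifP => _; rewrite ?rmorphN ?rmorph1.
Qed.

Section Period.
Variables (C : numClosedFieldType) (w : 'rV[C]_6).
Hypothesis w_iso : Cform form24 w w = 0.
Hypothesis w_pos : 0 < Cform form24 w (conjv w).

Let S : 'M[C]_6 := map_mx ratr form24.
Let h := Cform form24 w (conjv w).
Let W : 'M[C]_(1 + 1, 6) := col_mx w (conjv w).
Let G : 'M[C]_(1 + 1) := block_mx 0 h%:M h%:M 0.

Let w_neq0 : w != 0.
Proof. by apply: contraTneq w_pos => ->; rewrite Cform0l ltxx. Qed.

Let wbar_neq0 : conjv w != 0.
Proof.
apply: contra_neq w_neq0 => w0.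
by rewrite -[w]conjvK w0; apply/matrixP=> i j; rewrite !mxE conjC0.
Qed.

Let wbar_iso : Cform form24 (conjv w) (conjv w) = 0.
Proof. by rewrite Cform_conj w_iso conjC0. Qed.

Let Gram : W *m S *m W^T = G.
Proof.
rewrite mul_col_mx tr_col_mx mul_col_mx !mul_mx_row.
have E x y : x *m S *m y^T = (Cform form24 x y)%:M by exact: mx11_scalar.
by rewrite !E w_iso wbar_iso (CformC form24_sym (conjv w)) -/h !raddf0.
Qed.

Let Gunit : G \in unitmx.
Proof.
rewrite unitmxE unitfE det_mx2 block_mxEul block_mxEur block_mxEdl block_mxEdr.
by rewrite !mxE /= mulr0 sub0r oppr_eq0 mulf_neq0 // gt_eqF.
Qed.

Definition period_perp := kermx (S *m W^T).

Definition period_piece (p : 'I_3) : 'M[C]_6 :=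
  match val p with 0%N => <<conjv w>>%MS | 1%N => period_perp | _ => <<w>>%MS end.

Lemma period_perpP (x : 'rV[C]_6) : (x <= period_perp)%MS <->
  Cform form24 x w = 0 /\ Cform form24 x (conjv w) = 0.
Proof.
rewrite /period_perp; split=> [/sub_kermxP|[xw xw']].
  rewrite mulmxA tr_col_mx mul_mx_row -[0]hsubmxK => /eq_row_mx[].
  by rewrite !linear0 => xw xw'; rewrite /Cform xw xw' mxE.
apply/sub_kermxP; rewrite mulmxA tr_col_mx mul_mx_row.
have E y : x *m S *m y^T = (Cform form24 x y)%:M by exact: mx11_scalar.
by rewrite !E xw xw' !raddf0 row_mx0.
Qed.

(** The two equations are independent because the Gram matrix [G] of [w] and its conjugate, a
    hyperbolic plane, is invertible. *)
Let perp_rank : \rank period_perp = 4.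
Proof.
rewrite mxrank_ker -mxrank_tr trmx_mul trmxK map_trmx form24_sym.
suff -> : \rank (W *m S) = 2 by [].
apply/eqP; rewrite eqn_leq rank_leq_row /=.
have : (1 + 1 <= \rank G)%N by rewrite (mxrank_unit Gunit).
by move/leq_trans; apply; rewrite -Gram mxrankM_maxl.
Qed.

Lemma period_full : (\sum_p period_piece p == 1%:M)%MS.
Proof.
rewrite submx1 /=.
have WT : (W <= \sum_p period_piece p)%MS.
  rewrite -addsmxE addsmx_sub (sumsmx_sup (2 : 'I_3)) /period_piece ?genmxE //=.
  by rewrite (sumsmx_sup (0 : 'I_3)) // genmxE.
(* The subtracted matrix is the orthogonal projection to the span of [W]; the difference lies in
   [period_perp]. *)
rewrite -[1%:M](subrK (S *m W^T *m invmx G *m W)) addmx_sub //.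
  have PT : (period_perp <= \sum_p period_piece p)%MS.
    exact: (sumsmx_sup (1 : 'I_3)).
  apply: submx_trans PT; apply/sub_kermxP; rewrite mulmxBl mul1mx -[_ *m W *m _]mulmxA (mulmxA W) Gram.
  by rewrite mulmxKV // subrr.
exact: submx_trans (submxMl _ _) WT.
Qed.

Lemma period_direct : mxdirect (\sum_p period_piece p)%MS.
Proof.
apply/mxdirectP => /=; rewrite (eqmxP period_full) mxrank1.
rewrite !big_ord_recl big_ord0 /period_piece /= !mxrank_gen perp_rank !rank_rV.
by rewrite w_neq0 wbar_neq0.
Qed.

Lemma period_conj p :
  (map_mx Num.conj (period_piece p) == period_piece (rev_ord p))%MS.
Proof.
case: p => [[|[|[|//]]] pP]; rewrite {1}/period_piece /=.
- have -> : rev_ord (Ordinal pP) = 2 by apply: val_inj.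
  by rewrite /period_piece /= !map_genmx conjvK !submx_refl.
- have -> : rev_ord (Ordinal pP) = 1 by apply: val_inj.
  have sub : (map_mx Num.conj period_perp <= period_perp)%MS.
    apply/row_subP => i; apply/period_perpP.
    have /period_perpP[xw xw'] := row_sub i period_perp.
    rewrite -map_row -{1}(conjvK w) !Cform_conj xw xw' conjC0; split=> //.
  apply/andP; split=> //; rewrite -[period_piece 1]/period_perp.
  by rewrite -(conjvK period_perp) map_submx.
- have -> : rev_ord (Ordinal pP) = 0 by apply: val_inj.
  by rewrite /period_piece /= !map_genmx !submx_refl.
Qed.

Definition period_hodge := Hodge2 period_full period_direct period_conj.

(* If the hermitian form were nonnegative on [x], it would be so on the span of
   [w], [conjv w] and [x], which has dimension 3 and so meets the negative
   definite subspace of codimension 2 where the first two coordinates vanish. *)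
Lemma period_neg (x : 'rV[C]_6) : (x <= period_perp)%MS -> x != 0 ->
  Cform form24 x (conjv x) < 0.
Proof.
move=> /period_perpP[xw xw'] x0.
pose q := Cform form24 x (conjv x).
have qreal : q \is Num.real.
  rewrite /q Cform24E rpred_sum // => i _; rewrite mxE -mulrA.
  have xr : x 0 i * (x 0 i)^* \is Num.real by rewrite ger0_real ?mul_conjC_ge0.
  by case: ifP => _; rewrite ?mul1r ?mulN1r ?rpredN.
rewrite real_ltNge ?real0 //; apply/negP => q0.
pose N := col_mx W x.
(* Three coefficients subject to two equations: some non-trivial combination of [w], [conjv w] and
   [x] has first two coordinates 0. *)
have [u u0 uN] : exists2 u : 'rV[C]_(1 + 1 + 1), u != 0 & u *m lsubmx (N : 'M[C]_(1 + 1 + 1, 2 + 4)) = 0.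
  have : kermx (lsubmx (N : 'M[C]_(1 + 1 + 1, 2 + 4))) != 0.
    rewrite -mxrank_eq0 mxrank_ker subn_eq0 -ltnNge.
    by rewrite (leq_ltn_trans (rank_leq_col _)).
  by case/rowV0Pn=> u /sub_kermxP uN u0; exists u.
pose v := u *m N.
pose al := lsubmx (lsubmx u) 0 0; pose be := rsubmx (lsubmx u) 0 0.
pose ga := rsubmx u 0 0.
have vE : v = al *: w + be *: conjv w + ga *: x.
  rewrite /v -[u]hsubmxK mul_row_col -[lsubmx u]hsubmxK mul_row_col.
  rewrite [lsubmx (lsubmx u)]mx11_scalar [rsubmx (lsubmx u)]mx11_scalar.
  by rewrite [rsubmx u]mx11_scalar !mul_scalar_mx.
have Hv : Cform form24 v (conjv v) = al * al^* * h + be * be^* * h + ga * ga^* * q.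
  rewrite vE !map_mxD !map_mxZ conjvK !(CformDl, CformDr, CformZl, CformZr).
  have wx : Cform form24 w (conjv x) = 0.
    by rewrite -[w]conjvK Cform_conj CformC ?form24_sym // xw' conjC0.
  have wx' : Cform form24 (conjv w) (conjv x) = 0.
    by rewrite Cform_conj CformC ?form24_sym // xw conjC0.
  rewrite w_iso wbar_iso xw xw' wx wx' (CformC form24_sym (conjv w) w) -/h -/q.
  by ring.
have v01 (i : 'I_6) : (i < 2)%N -> v 0 i = 0.
  move=> i2; have -> : i = lshift 4 (Ordinal i2) by apply: val_inj.
  transitivity ((u *m lsubmx (N : 'M[C]_(1 + 1 + 1, 2 + 4))) 0 (Ordinal i2)).
    by rewrite mulmx_lsub [RHS]mxE.
  by rewrite uN mxE.
have Nv (i : 'I_6) : (if (i < 2)%N then 1 else -1) * v 0 i * (conjv v) 0 i = - (v 0 i * (v 0 i)^*).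
  by rewrite [conjv v _ _]mxE; case: ifP => [/v01->|_]; rewrite ?mulr0 ?mul0r ?oppr0 ?mulN1r ?mulNr.
have al0 : 0 <= al * al^* * h by rewrite mulr_ge0 ?mul_conjC_ge0 // ltW.
have be0 : 0 <= be * be^* * h by rewrite mulr_ge0 ?mul_conjC_ge0 // ltW.
have ga0 : 0 <= ga * ga^* * q by rewrite mulr_ge0 ?mul_conjC_ge0.
have : Cform form24 v (conjv v) <= 0.
  rewrite Cform24E (eq_bigr _ (fun i _ => Nv i)) sumrN oppr_le0.
  by rewrite sumr_ge0 // => i _; rewrite mul_conjC_ge0.
rewrite Hv => Hle0.
have [/andP[/eqP al00 /eqP be00] Hv0] :
    (al * al^* * h == 0) && (be * be^* * h == 0) /\ Cform form24 v (conjv v) = 0.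
  have : al * al^* * h + be * be^* * h + ga * ga^* * q == 0.
    by rewrite eq_le Hle0 !addr_ge0.
  move=> e0; rewrite Hv; split; last exact/eqP.
  by move: e0; rewrite !paddr_eq0 ?addr_ge0 // => /andP[].
have z0 (z : C) r : 0 < r -> z * z^* * r = 0 -> z = 0.
  move=> r0 /eqP; rewrite mulf_eq0 (gt_eqF r0) orbF mul_conjC_eq0 => /eqP.
  by [].
have {}al00 := z0 _ _ w_pos al00; have {}be00 := z0 _ _ w_pos be00.
(* As [q] may be 0, [Hv] does not give [ga = 0]. Instead [v] has norm 0 in a negative definite
   subspace, hence [v = 0], and [x != 0] then yields [ga = 0]. *)
have v0 : v = 0.
  move/eqP: Hv0; rewrite Cform24E (eq_bigr _ (fun i _ => Nv i)) sumrN oppr_eq0.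
  rewrite psumr_eq0 => [/allP vi|i _]; last by rewrite mul_conjC_ge0.
  apply/rowP => i; rewrite [RHS]mxE; apply/eqP; rewrite -mul_conjC_eq0.
  by apply: vi; rewrite mem_index_enum.
have : ga *: x = 0 by rewrite -v0 vE al00 be00 !scale0r !add0r.
move/eqP; rewrite scaler_eq0 (negPf x0) orbF => /eqP ga00.
case/negP: u0; apply/eqP; rewrite -[u]hsubmxK -[lsubmx u]hsubmxK.
rewrite [lsubmx (lsubmx u)]mx11_scalar [rsubmx (lsubmx u)]mx11_scalar.
rewrite [rsubmx u]mx11_scalar -/al -/be -/ga al00 be00 ga00 !raddf0.
by rewrite !row_mx0.
Qed.

Lemma period_polarization : polarization period_hodge form24.
Proof.
split.
- exact: form24_sym.
- exact: form24_unit.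
- move=> [[|[|[|//]]] pP] [[|[|[|//]]] qP] x y; rewrite /= /period_piece /= ?genmxE.
  + by move=> /sub_rVP[k ->] /sub_rVP[l ->] _; rewrite CformZl CformZr wbar_iso !mulr0.
  + move=> /sub_rVP[k ->] /period_perpP[_ yw] _.
    by rewrite CformZl CformC ?form24_sym // yw mulr0.
  + by [].
  + by move=> /period_perpP[_ xw] /sub_rVP[k ->] _; rewrite CformZr xw mulr0.
  + by [].
  + by move=> /period_perpP[xw _] /sub_rVP[k ->] _; rewrite CformZr xw mulr0.
  + by [].
  + move=> /sub_rVP[k ->] /period_perpP[yw _] _.
    by rewrite CformZl CformC ?form24_sym // yw mulr0.
  + by move=> /sub_rVP[k ->] /sub_rVP[l ->] _; rewrite CformZl CformZr w_iso !mulr0.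
- move=> x; rewrite /H20 /H02 /= /period_piece /= !genmxE.
  case/orP=> /sub_rVP[k ->]; rewrite scaler_eq0 negb_or => /andP[k0 _];
    rewrite map_mxZ CformZl CformZr mulrA; apply: mulr_gt0; rewrite ?mul_conjC_gt0 //.
  by rewrite conjvK CformC ?form24_sym.
- by move=> x /period_neg.
Qed.

Lemma period_K3 : K3_type period_hodge.
Proof.
by rewrite /K3_type /H20 /= /period_piece /= mxrank_gen rank_rV w_neq0.
Qed.
Lemma period_H20 : (H20 period_hodge == w)%MS.
Proof.
by rewrite /H20 /= /period_piece /= !genmxE submx_refl.
Qed.
End Period.

(** * The conic of periods *)

(* Missing entries and rows are 0. *)
Definition seqmx (R : nmodType) m n (rows : seq (seq R)) : 'M[R]_(m, n) :=
  \matrix_(i, j) nth 0 (nth [::] rows i) j.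

Ltac seqmx_entries :=
  apply/matrixP => -[[|[|[|[|[|[|?]]]]]] // ?] [[|[|[|[|[|[|?]]]]]] // ?];
  rewrite ?(mxE, big_ord_recl, big_ord0) /=.

Section Family.
Variables (d b c : rat).
Hypotheses (dbc : d = b ^+ 2 + c ^+ 2) (dN : ~ rat_square d).

(* [p ^+ 2 - q ^+ 2 = d], so that [[p, q], [- q, - p]] is a square root of [d]
   that is self-adjoint for diag(1, -1); it is used on the coordinates (0, 2)
   and (1, 3). *)
Definition sqrt_endo : 'M[rat]_6 :=
  let p := (d + 1) / 2 in let q := (d - 1) / 2 in
  seqmx _ _
    [:: [:: p; 0; q; 0; 0; 0]; [:: 0; p; 0; q; 0; 0];
        [:: - q; 0; - p; 0; 0; 0]; [:: 0; - q; 0; - p; 0; 0];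
        [:: 0; 0; 0; 0; b; c]; [:: 0; 0; 0; 0; c; - b]].

(* The rows of [eig_rat + s eig_irr] are eigenvectors of [sqrt_endo] for
   [s = sqrt d]. *)
Definition eig_rat : 'M[rat]_(3, 6) :=
  seqmx _ _ [:: [:: 1; 0; -1]; [:: 0; 1; 0; -1]; [:: 0; 0; 0; 0; c; - b]].

Definition eig_irr : 'M[rat]_(3, 6) :=
  seqmx _ _ [:: [:: 1; 0; 1]; [:: 0; 1; 0; 1]; [:: 0; 0; 0; 0; 0; 1]].

Lemma c_neq0 : c != 0.
Proof. by apply/eqP => c0; apply: dN; exists b; rewrite dbc c0 expr0n addr0. Qed.

Lemma eig_ratM : eig_rat *m sqrt_endo = d *: eig_irr.
Proof. by seqmx_entries; rewrite ?dbc; field. Qed.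

Lemma eig_irrM : eig_irr *m sqrt_endo = eig_rat.
Proof. by seqmx_entries; rewrite ?dbc; field. Qed.

Lemma sqrt_endo_adj : sqrt_endo *m form24 = form24 *m sqrt_endo^T.
Proof. rewrite /form24 mul_mx_diag mul_diag_mx; by seqmx_entries; ring. Qed.

(** The rows of [eig_rat] and [eig_irr] together form a basis of the rational space; [X] and [Y] are
    the two halves of the inverse of its matrix. *)
Lemma eig_inj n (N : 'M[rat]_(6, n)) :
  eig_rat *m N = 0 -> eig_irr *m N = 0 -> N = 0.
Proof.
have c0 := c_neq0.
pose X : 'M[rat]_(6, 3) := seqmx _ _
  [:: [:: 1/2]; [:: 0; 1/2]; [:: -1/2]; [:: 0; -1/2]; [:: 0; 0; c^-1]].
pose Y : 'M[rat]_(6, 3) := seqmx _ _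
  [:: [:: 1/2]; [:: 0; 1/2]; [:: 1/2]; [:: 0; 1/2]; [:: 0; 0; b / c]; [:: 0; 0; 1]].
have XY : X *m eig_rat + Y *m eig_irr = 1%:M.
  by seqmx_entries; field; rewrite ?c0.
by move=> rN iN; rewrite -[N]mul1mx -XY mulmxDl -!mulmxA rN iN !mulmx0 addr0.
Qed.

Lemma sqrt_endo_sqr : sqrt_endo *m sqrt_endo = d%:M.
Proof.
apply/eqP; rewrite -subr_eq0; apply/eqP.
by apply: eig_inj; rewrite mulmxBr mulmxA ?eig_ratM ?eig_irrM -?scalemxAl
  ?eig_ratM ?eig_irrM mul_mx_scalar subrr.
Qed.

Lemma d_neq1 : d - 1 != 0.
Proof. by rewrite subr_eq0; apply/eqP => d1; apply: dN; exists 1; rewrite expr1n. Qed.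

Lemma d_gt0 : 0 < d.
Proof.
rewrite lt_neqAle dbc addr_ge0 ?sqr_ge0 // andbT eq_sym -dbc.
by apply/eqP => d0; apply: dN; exists 0; rewrite expr0n.
Qed.

Variable C : numClosedFieldType.
Let s : C := sqrtC (ratr d).

Lemma s_sqr : s ^+ 2 = ratr d. Proof. exact: sqrtCK. Qed.

Lemma s_gt0 : 0 < s. Proof. by rewrite sqrtC_gt0 ltr0q d_gt0. Qed.

Lemma s_irr (x y : rat) : ratr x + s * ratr y = 0 -> x = 0 /\ y = 0.
Proof.
move=> xy; have [y0|y0] := eqVneq y 0.
  by move/eqP: xy; rewrite y0 rmorph0 mulr0 addr0 fmorph_eq0 => /eqP.
exfalso; apply: dN; exists (x / y); apply: (fmorph_inj (@ratr C)).
rewrite /= -s_sqr rmorphXn fmorph_div -sqrrN; congr (_ ^+ 2).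
have y0' : ratr y != 0 :> C by rewrite fmorph_eq0.
apply: (mulIf y0'); rewrite divfK // mulNr; apply/eqP.
by rewrite eq_sym -subr_eq0 opprK xy.
Qed.

(** Since [s^2 = b^2 + c^2] with [c != 0]. This makes [kap] positive, so that the eigenspace has
    signature (2, 1). *)
Lemma s_gtb : ratr b < s.
Proof.
have [b0|b0] := leP b 0.
  by apply: le_lt_trans s_gt0; rewrite lerq0.
rewrite -(ltr_pXn2r (n := 2)) ?nnegrE ?ler0q ?(ltW b0) ?(ltW s_gt0) //.
rewrite s_sqr -rmorphXn ltr_rat dbc ltrDl.
by rewrite lt_neqAle sqr_ge0 andbT eq_sym expf_eq0 /= c_neq0.
Qed.

Lemma s_conj : s^* = s.
Proof. by apply/CrealP; rewrite gtr0_real ?s_gt0. Qed.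

(* The eigenvectors are orthogonal with norms [4 s], [4 s] and [- 4 s kap]. *)
Let kap : C := (s - ratr b) / 2.

Lemma kap_gt0 : 0 < kap.
Proof. by rewrite divr_gt0 // subr_gt0 s_gtb. Qed.

Lemma kap_conj : kap^* = kap.
Proof. by apply/CrealP; rewrite gtr0_real ?kap_gt0. Qed.

Definition eigvec : 'M[C]_(3, 6) := map_mx ratr eig_rat + s *: map_mx ratr eig_irr.

Lemma eigvecM : eigvec *m map_mx ratr sqrt_endo = s *: eigvec.
Proof.
rewrite /eigvec mulmxDl -scalemxAl -!map_mxM eig_ratM eig_irrM map_mxZ /= -s_sqr.
by rewrite scalerDr scalerA expr2 addrC.
Qed.

(* With [u0], [u1], [u2] the rows of [eigvec], this makes [period t] equal to
   [(1 + kap t^2) u0 - i (1 - kap t^2) u1 + 2 t u2], the rational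
   parametrization of the conic [x0^2 + x1^2 = kap x2^2]. *)
Definition conic : 'M[C]_3 :=
  seqmx _ _ [:: [:: 1; - 'i]; [:: 0; 0; 2]; [:: kap; kap * 'i]].

Definition powers (t : C) : 'rV[C]_3 := \row_j t ^+ j.

Definition period (t : C) : 'rV[C]_6 := powers t *m (conic *m eigvec).

Lemma conic_unit : conic \in unitmx.
Proof.
have k0 := lt0r_neq0 kap_gt0.
pose H : 'M[C]_3 := seqmx _ _
  [:: [:: 2^-1; 0; (2 * kap)^-1]; [:: 'i / 2; 0; - 'i / (2 * kap)]; [:: 0; 2^-1]].
suff /mulmx1_unit[] : H *m conic = 1%:M by [].
have i2 := sqrCi C.
by seqmx_entries; field : i2; rewrite ?k0.
Qed.

Lemma eigvec_free : row_free eigvec.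
Proof.
have c0 : ratr c != 0 :> C by rewrite fmorph_eq0 c_neq0.
have s1 : s + 1 != 0 by rewrite lt0r_neq0 // addr_gt0 ?s_gt0.
(* Columns 0, 1 and 4 of [eigvec] form the diagonal matrix with entries [s + 1], [s + 1], [c]. *)
pose H : 'M[C]_(6, 3) := seqmx _ _
  [:: [:: (s + 1)^-1]; [:: 0; (s + 1)^-1]; [::]; [::]; [:: 0; 0; (ratr c)^-1]].
apply/row_freeP; exists H.
by seqmx_entries; rewrite ?(rmorph0, rmorph1, rmorphN); field; rewrite ?c0 ?s1.
Qed.

Let D : 'M[C]_3 := seqmx _ _ [:: [:: 1]; [:: 0; 1]; [:: 0; 0; - kap]].

Lemma eigvec_gram :
  eigvec *m map_mx ratr form24 *m eigvec^T = (4 * s) *: D.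
Proof.
have bc : ratr c ^+ 2 = s ^+ 2 - ratr b ^+ 2.
  by rewrite s_sqr dbc rmorphD !rmorphXn /= addrC addKr.
rewrite /form24 map_diag_mx mul_mx_diag.
by seqmx_entries; rewrite ?(rmorph0, rmorph1, rmorphN) /kap; field: bc.
Qed.

Lemma Cform_eigvec (x y : 'rV[C]_3) :
  Cform form24 (x *m eigvec) (y *m eigvec) = 4 * s * (x *m D *m y^T) 0 0.
Proof.
rewrite /Cform trmx_mul !mulmxA -(mulmxA x) -(mulmxA x) eigvec_gram.
by rewrite -scalemxAr -scalemxAl mxE.
Qed.

Lemma eigvec_conj : conjv eigvec = eigvec.
Proof. by rewrite /eigvec map_mxD map_mxZ !map_conj_ratr /= s_conj. Qed.

Lemma period_iso t : Cform form24 (period t) (period t) = 0.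
Proof.
rewrite /period mulmxA Cform_eigvec; apply/eqP; rewrite mulf_eq0; apply/orP; right.
have i2 := sqrCi C.
rewrite trmx_mul !mulmxA -(mulmxA _ conic) -(mulmxA _ _ conic^T).
(* On [(1, t, t^2)] this matrix takes the value [2 * (2 kap) * t^2 - 4 kap * t^2 = 0]. *)
have -> : conic *m D *m conic^T =
    seqmx _ _ [:: [:: 0; 0; 2 * kap]; [:: 0; - 4 * kap]; [:: 2 * kap]].
  by seqmx_entries; ring: i2.
rewrite ?(mxE, big_ord_recl, big_ord0) /=; apply/eqP; ring.
Qed.

(** In the powers of [t] the hermitian form is diagonal with entries [2], [- 4 kap], [2 kap^2], up
    to the factor [4 s], which is a perfect square in [kap |t|^2]. *)
Lemma period_herm t :
  Cform form24 (period t) (conjv (period t)) = 8 * s * (1 - kap * `|t| ^+ 2) ^+ 2.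
Proof.
rewrite /period mulmxA map_mxM eigvec_conj Cform_eigvec map_mxM.
have i2 := sqrCi C.
rewrite trmx_mul !mulmxA -(mulmxA _ conic) -(mulmxA _ _ (conjv conic)^T).
have -> : conic *m D *m (conjv conic)^T =
    seqmx _ _ [:: [:: 2]; [:: 0; - 4 * kap]; [:: 0; 0; 2 * kap ^+ 2]].
  seqmx_entries; rewrite ?(rmorph0, rmorph1, rmorphN, rmorphM _ kap, rmorph_nat) /=;
    by rewrite ?(conjCi, kap_conj); ring: i2.
rewrite normCK ?(mxE, big_ord_recl, big_ord0) /= ?rmorphXn /=; ring.
Qed.

Lemma period_pos t : kap * `|t| ^+ 2 < 1 ->
  0 < Cform form24 (period t) (conjv (period t)).
Proof.
move=> t1; rewrite period_herm; apply: mulr_gt0; first by rewrite mulr_gt0 ?s_gt0.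
by rewrite exprn_gt0 ?subr_gt0.
Qed.

(** Both matrices being injective, the vectors of powers are proportional. Their coordinate 0 is 1,
    which fixes the factor, and coordinate 1 is the parameter. *)
Lemma period_inj t u : (period t == period u)%MS -> t = u.
Proof.
case/andP=> /sub_rVP[k]; rewrite /period => tu _; move: tu.
rewrite scalemxAl mulmxA mulmxA => /(row_free_inj eigvec_free).
move/(can_inj (mulmxK conic_unit)) => e.
have := congr1 (fun x : 'rV_3 => x 0 0) e.
have := congr1 (fun x : 'rV_3 => x 0 1) e.
by rewrite !mxE !expr0 !expr1 mulr1 => -> <-; rewrite mul1r.
Qed.

Lemma period_eig t : period t *m map_mx ratr sqrt_endo = s *: period t.
Proof. by rewrite /period -!mulmxA eigvecM -!scalemxAr. Qed.

Lemma period_neq0 t : period t != 0.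
Proof.
apply/eqP; rewrite /period mulmxA -[0](mul0mx 1 eigvec) => /(row_free_inj eigvec_free).
rewrite -[0](mul0mx 1 conic) => /(can_inj (mulmxK conic_unit)).
move/(congr1 (fun x : 'rV_3 => x 0 0)); rewrite !mxE expr0 => /eqP.
by rewrite oner_eq0.
Qed.

(** One entry of the equation puts [lam] in [Q(s)], say [lam = x + y s]. Then [M - x - y sqrt_endo]
    kills [eigvec]; by irrationality of [s] it kills [eig_rat] and [eig_irr] separately, so it is
    0. *)
Lemma eigvec_spectral (M : 'M[rat]_6) lam :
  eigvec *m map_mx ratr M = lam *: eigvec ->
  exists x y, M = x%:M + y *: sqrt_endo.
Proof.
have d1 := d_neq1.
have linE (X Y : 'M[rat]_(3, 6)) i j :
    (map_mx ratr X + s *: map_mx ratr Y) i j = ratr (X i j) + s * ratr (Y i j).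
  by rewrite !mxE.
set m := (eig_rat *m M) 0 0; set n := (eig_irr *m M) 0 0.
(* The solution of [m + s n = (x + s y) (1 + s)], where [1 + s] is entry (0, 0) of [eigvec]. *)
move=> E; pose x := (n * d - m) / (d - 1); pose y := (m - n) / (d - 1).
have lamE : lam = ratr x + s * ratr y.
  have s1 : 1 + s != 0 by rewrite lt0r_neq0 // addr_gt0 ?s_gt0.
  apply: (mulIf s1).
  have := congr1 (fun X : 'M[C]_(3, 6) => X 0 0) E.
  rewrite /eigvec mulmxDl -scalemxAl -!map_mxM.
  rewrite linE [RHS]mxE linE -/m -/n !mxE /= !rmorph1 mulr1 => <-.
  have -> : m = x + d * y by rewrite /x /y; field.
  have -> : n = x + y by rewrite /x /y; field.
  by rewrite !rmorphD rmorphM /= -s_sqr; ring.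
exists x, y; apply/eqP; rewrite -subr_eq0; apply/eqP.
set N := M - _.
have EN : map_mx ratr (eig_rat *m N) + s *: map_mx ratr (eig_irr *m N) = 0 :> 'M[C]_(3, 6).
  rewrite !map_mxM scalemxAl -mulmxDl -/eigvec /N map_mxB map_mxD map_mxZ.
  rewrite map_scalar_mx mulmxBr mulmxDr E -scalemxAr eigvecM mul_mx_scalar.
  by rewrite /= lamE scalerA -scalerDl mulrC subrr.
by apply: eig_inj; apply/matrixP=> i j;
  have := congr1 (fun X : 'M[C]_(3, 6) => X i j) EN;
  rewrite linE [RHS]mxE => /s_irr[e1 e2]; rewrite [RHS]mxE.
Qed.

End Family.

(** * Periods with additional endomorphisms *)

Section Exceptional.
Local Open Scope classical_set_scope.

Lemma finite_roots (F : closedFieldType) (p : {poly F}) :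
  p != 0 -> finite_set [set x | root p x].
Proof.
move=> p0; have [r pE] := closed_field_poly_normal p.
apply: sub_finite_set (finite_seq r) => x /=.
by rewrite pE rootZ ?lead_coef_eq0 // root_prod_XsubC.
Qed.

(** Only the period line is required to be stable under [M]. This is implied by [M] being a Hodge
    endomorphism, and it is a polynomial condition on [t]. *)
Definition exceptional d b c (C : numClosedFieldType) : set C :=
  [set t | exists2 M : 'M[rat]_6,
     ~ (exists x y, M = x%:M + y *: sqrt_endo d b c) &
     exists lam, period d b c t *m map_mx ratr M = lam *: period d b c t].

Lemma exceptional_countable d b c (C : numClosedFieldType) :
  d = b ^+ 2 + c ^+ 2 -> ~ rat_square d -> countable (@exceptional d b c C).
Proof.
move=> dbc dN; pose bad := [set M : 'M[rat]_6 |
  ~ (exists x y, M = x%:M + y *: sqrt_endo d b c)].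
pose Z (M : 'M[rat]_6) (lam : C) :=
  [set t | period d b c t *m (map_mx ratr M - lam%:M) = 0].
apply: (@sub_countable _ _ _ (\bigcup_(M in bad)
   \bigcup_(lam in [set lam : C | root (char_poly (map_mx ratr M)) lam]) Z M lam)).
  apply: subset_card_le => t [M Mbad [lam Mt]]; exists M => //; exists lam.
    rewrite /= -eigenvalue_root_char; apply/eigenvalueP.
    by exists (period d b c t) => //; apply: period_neq0.
  by rewrite /Z /= mulmxBr Mt mul_mx_scalar subrr.
apply: bigcup_countable; first exact: countableP.
move=> M Mbad; apply: bigcup_countable.
  apply: finite_set_countable; apply: finite_roots.
  by rewrite monic_neq0 ?char_poly_monic.
move=> lam _; apply: finite_set_countable.
set X := conic d b C *m eigvec d b c C *m (map_mx ratr M - lam%:M).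
(* If [X] were 0, then, [conic] being invertible, [M] would act as [lam] on the whole eigenspace. A
   non-zero entry gives a non-zero polynomial [p], with coefficients in column [j], that vanishes on
   [Z M lam]. *)
have [i [j Xij]] : exists i j, X i j != 0.
  apply/matrix0Pn; apply/eqP => X0; apply: Mbad.
  apply: (@eigvec_spectral _ _ _ dbc dN C _ lam).
  apply/eqP; rewrite -subr_eq0 -mul_mx_scalar -mulmxBr; apply/eqP.
  apply: (can_inj (mulKmx (conic_unit dbc dN C))).
  by rewrite mulmx0 mulmxA.
pose p : {poly C} := \poly_(k < 3) X (inord k) j.
have p0 : p != 0.
  apply: contra_neq Xij => /(congr1 (fun q : {poly C} => q`_i)).
  by rewrite coef_poly ltn_ord inord_val coef0.
apply: sub_finite_set (finite_roots p0) => t /=.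
rewrite /Z /= /period -mulmxA -/X => /(congr1 (fun x : 'rV_6 => x 0 j)).
rewrite [LHS]mxE [RHS]mxE => e; apply/eqP; rewrite horner_poly -{}[RHS]e.
by apply: eq_bigr => k _; rewrite inord_val [powers _ _ _]mxE mulrC.
Qed.

End Exceptional.

(** * Endomorphism algebras generated by a square root of [d] *)

Lemma scalar_mx_eq0 (R : pzRingType) n (a : R) :
  (a%:M == 0 :> 'M[R]_n.+1) = (a == 0).
Proof.
apply/eqP/eqP => [|->]; last exact: raddf0.
by move/(congr1 (fun X : 'M[R]_n.+1 => X 0 0)); rewrite !mxE eqxx mulr1n.
Qed.

Lemma size_Qsqrt d (p : Qsqrt d) : (size (p : {poly rat}) <= 2)%N.
Proof.
rewrite -ltnS; apply: leq_trans (size_mk_monic p) _.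
by rewrite Qsqrt_monic size_XnsubC.
Qed.

Section QuadraticEnd.
Variables (C : numClosedFieldType) (n : nat) (T : hodge2 C n.+1) (d : rat).
Variable A : 'M[rat]_n.+1.
Hypotheses (dN : ~ rat_square d) (d_gt0 : 0 < d).
Hypotheses (AT : A \in hodge_endo T) (AA : A *m A = d%:M).
Hypothesis AE : forall M, M \in hodge_endo T -> exists x y, M = x%:M + y *: A.

Lemma scalar_hodge_endo (a : rat) : a%:M \in hodge_endo T.
Proof.
apply/forallP => p; rewrite map_scalar_mx mul_mx_scalar.
exact: scalemx_sub.
Qed.

Lemma lin_hodge_endo (x y : rat) : x%:M + y *: A \in hodge_endo T.
Proof.
rewrite -mul_scalar_mx rpredD ?rpredM ?scalar_hodge_endo //.
Qed.

Lemma sqrt_indep x y : x%:M + y *: A = 0 -> x = 0 /\ y = 0.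
Proof.
have [-> /eqP|y0 /eqP] := eqVneq y 0.
  by rewrite scale0r addr0 scalar_mx_eq0 => /eqP.
rewrite addr_eq0 => /eqP xA.
exfalso; apply: dN; exists (x / y).
have AE' : A = (- (x / y))%:M.
  apply: (scalerI y0); rewrite scale_scalar_mx mulrN mulrC divfK //.
  by rewrite (raddfN (@scalar_mx _ _)) /= xA opprK.
move: AA; rewrite AE' -scalar_mxM => /(congr1 (fun X : 'M[rat]_n.+1 => X 0 0)).
by rewrite !mxE eqxx !mulr1n mulrNN expr2 => ->.
Qed.

Definition quad_mx (p : Qsqrt d) : 'M[rat]_n.+1 := horner_mx A p.

Lemma quad_mxE p : quad_mx p = ((p : {poly rat})`_0)%:M + (p : {poly rat})`_1 *: A.
Proof.
have := size_Qsqrt p; rewrite /quad_mx; move: (polyn p) => q sp.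
have -> : q = (q`_0)%:P + q`_1 *: 'X.
  apply/polyP => k; rewrite coefD coefC coefZ coefX.
  case: k => [|[|k]] /=; rewrite ?mulr0 ?mulr1 ?addr0 ?add0r //.
  by rewrite nth_default // (leq_trans sp).
rewrite linearD linearZ /= horner_mx_C horner_mx_X coefD coefC coefZ coefX /=.
by rewrite !coefD !coefC !coefZ !coefX /= !mulr0 !mulr1 !addr0 !add0r.
Qed.

Lemma quad_mx_endo p : quad_mx p \in hodge_endo T.
Proof. by rewrite quad_mxE lin_hodge_endo. Qed.

Definition quad_End p : hodge_End T := HodgeEnd (quad_mx_endo p).

Lemma quad_End_zmod : zmod_morphism quad_End.
Proof.
move=> p q; apply: val_inj; rewrite [RHS]hodge_EndB /=.
by rewrite /quad_mx -rmorphB.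
Qed.

(** Evaluation at [A] ignores reduction because [X^2 - d] annihilates [A]; this makes [quad_mx]
    multiplicative. *)
Lemma horner_mx_mod (p : {poly rat}) :
  horner_mx A (Pdiv.CommonRing.rmodp p (mk_monic ('X^2 - d%:P))) = horner_mx A p.
Proof.
rewrite Qsqrt_monic.
rewrite [p in RHS](Pdiv.RingMonic.rdivp_eq (monicXnsubC d (isT : 0 < 2)%N)).
have hA0 : horner_mx A ('X^2 - d%:P) = 0.
  rewrite rmorphB /= rmorphXn /= horner_mx_X horner_mx_C; apply/eqP.
  by rewrite subr_eq0; apply/eqP; exact: AA.
by rewrite rmorphD rmorphM /= hA0 mulr0 add0r.
Qed.

Lemma quad_End_monoid : monoid_morphism quad_End.
Proof.
split; first by apply: val_inj; rewrite [RHS]hodge_End1 /= /quad_mx rmorph1.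
move=> p q; apply: val_inj; rewrite [RHS]hodge_EndM /=.
by rewrite /quad_mx poly_of_qpolyM horner_mx_mod rmorphM.
Qed.

HB.instance Definition _ :=
  GRing.isZmodMorphism.Build (Qsqrt d) (hodge_End T) quad_End quad_End_zmod.
HB.instance Definition _ :=
  GRing.isMonoidMorphism.Build (Qsqrt d) (hodge_End T) quad_End quad_End_monoid.

Lemma quad_End_surj M : exists p, quad_End p = M.
Proof.
case: M => M MT; have [x [y Mxy]] := AE MT.
exists (in_qpoly _ (x%:P + y *: 'X)); apply: val_inj => /=.
rewrite /quad_mx /= horner_mx_mod linearD linearZ /=.
by rewrite horner_mx_C horner_mx_X Mxy.
Qed.

Lemma quad_End_inj : injective quad_End.
Proof.
move=> p q /(congr1 (@hodge_End_mx _ _ _)) /= pq; apply/eqP; rewrite -subr_eq0.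
have : quad_mx (p - q) = 0 by rewrite /quad_mx rmorphB /= -/(quad_mx _) pq subrr.
rewrite quad_mxE => /sqrt_indep[p0 p1].
apply/eqP; apply: val_inj => /=; apply/polyP => -[|[|k]]; rewrite ?coef0 //.
by rewrite nth_default //; apply: leq_trans (size_Qsqrt (p - q)) _.
Qed.

Lemma quad_End_bij : bijective quad_End.
Proof.
have [g gE] := choice quad_End_surj.
exists g => // p; exact: quad_End_inj.
Qed.

Lemma quad_field : is_field (hodge_End T).
Proof.
split.
- apply/eqP => /(congr1 (@hodge_End_mx _ _ _)); rewrite hodge_End1.
  by move/eqP; rewrite scalar_mx_eq0 oner_eq0.
- move=> x y; have [p <-] := quad_End_surj x; have [q <-] := quad_End_surj y.
  by rewrite -!rmorphM mulrC.
move=> [M MT] M0; have [x [y Mxy]] := AE MT.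
have N0 : x ^+ 2 - d * y ^+ 2 != 0.
  apply: contraNneq M0 => N0; apply/eqP/val_inj => /=.
  have [y0|y0] := eqVneq y 0.
    move/eqP: N0; rewrite y0 expr0n mulr0 subr0 sqrf_eq0 => /eqP x0.
    by rewrite Mxy x0 y0 scale0r addr0 raddf0.
  exfalso; apply: dN; exists (x / y); rewrite expr_div_n.
  by move/eqP: N0; rewrite subr_eq0 => /eqP ->; rewrite mulfK ?sqrf_eq0.
set N := x ^+ 2 - d * y ^+ 2 in N0.
(* The conjugate of [x + y A] divided by its norm [N]. *)
exists (HodgeEnd (lin_hodge_endo (x / N) (- y / N))); apply: val_inj.
rewrite [LHS]hodge_EndM [RHS]hodge_End1 /= Mxy mulmxDl !mulmxDr -!scalemxAl -!scalemxAr AA.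
rewrite !mul_mx_scalar !mul_scalar_mx; apply/matrixP => i j; rewrite !mxE.
by case: (i == j); rewrite ?mulr1n ?mulr0n /N; field.
Qed.

(** An embedding is [ratr] on constants and sends [A] to a square root of [d > 0], that is to one of
    the two real numbers [sqrtC (ratr d)] and its opposite. *)
Lemma quad_totally_real : totally_real C (hodge_End T).
Proof.
move=> f M; have [p <-] := quad_End_surj M.
have fC a : f (quad_End (qpolyC _ a)) = ratr a.
  exact: (fmorph_eq_rat (f \o quad_End \o qpolyC ('X^2 - d%:P))).
have fM : f (quad_End p) = ratr (p : {poly rat})`_0
                         + ratr (p : {poly rat})`_1 * f (HodgeEnd AT).
  rewrite -!fC -rmorphM -rmorphD; congr (f _); apply: val_inj.
  rewrite [RHS]hodge_EndD [LHS](quad_mxE p) [X in _ = _ + X]hodge_EndM.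
  by rewrite /= /quad_mx !qpolyCE !horner_mx_C mul_scalar_mx.
have fA : f (HodgeEnd AT) ^+ 2 = ratr d.
  rewrite -fC -rmorphXn; congr (f _); apply: val_inj.
  by rewrite expr2 [LHS]hodge_EndM /= AA /quad_mx qpolyCE horner_mx_C.
have realQ (a : rat) : ratr a \is @Num.real C.
  by apply/CrealP; exact: fmorph_rat.
suff rA : f (HodgeEnd AT) \is @Num.real C.
  by rewrite fM; apply: rpredD; [|apply: rpredM].
have : f (HodgeEnd AT) ^+ 2 == sqrtC (ratr d) ^+ 2 by rewrite fA sqrtCK.
have sr : sqrtC (ratr d) \is @Num.real C.
  by rewrite ger0_real // sqrtC_ge0 ler0q ltW.
by rewrite eqf_sqr => /orP[] /eqP ->; rewrite ?rpredN.
Qed.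

Lemma quad_real_mult_by S : polarization T S -> K3_type T -> real_mult_by (Qsqrt d) T S.
Proof.
move=> pol K3; split.
  split=> //; [exact: quad_field | exact: quad_totally_real |].
  exists (HodgeEnd AT) => a /= Aa; have := @sqrt_indep (- a) 1.
  by rewrite scale1r {1}Aa raddfN addNr => /(_ erefl)[_ /eqP].
exists quad_End; exact: quad_End_bij.
Qed.
End QuadraticEnd.

(** * Connectedness of discs and holomorphy of quadratic polynomials *)

Section Topology.
Local Open Scope classical_set_scope.

Variable R : realType.
Let C : numFieldType := R[i].

Lemma continuous_real_complex (t : C) : continuous (fun x : R => (x%:C%C : C) * t).
Proof.
move=> x; apply/cvgrPdist_lt => e e0; have [->|t0] := eqVneq t 0.
  by near=> y; rewrite !mulr0 subrr normr0.
have et0 : 0 < e / `|t| by rewrite divr_gt0 ?normr_gt0.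
(* Being positive in [R[i]] includes having imaginary part 0, so the bound can be moved to [R]. *)
have eR : e / `|t| = (complex.Re (e / `|t|))%:C%C.
  by apply/esym/eqP; rewrite eq_complex /=; move: et0; rewrite ltcE => /andP[/eqP -> _]; rewrite /= !eqxx.
have e'0 : 0 < complex.Re (e / `|t|) by rewrite -ltcR -eR.
near=> y; rewrite -mulrBl normrM -ltr_pdivlMr ?normr_gt0 // eR.
rewrite -rmorphB /= normc_def /= expr0n addr0 sqrtr_sqr ltcR.
by near: y; apply: (@cvgr_dist_lt _ _ _ _ _ id).
Unshelve. all: by end_near. Qed.

(** The disc is star-shaped: it is the union of the segments from 0 to its points, which all contain
    0. *)
Lemma connected_ball0 (r : C) : 0 < r -> connected (ball (0 : C) r).
Proof.
move=> r0.
pose seg (t : C) : set C := [set (x%:C%C : C) * t | x in `[0, 1]%classic].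
have -> : ball (0 : C) r = \bigcup_(t in ball (0 : C) r) seg t.
  apply/seteqP; split=> [t rt|u [t rt [x]]].
    by exists t => //; exists 1; rewrite ?mul1r //= in_itv /= ler01 lexx.
  rewrite /= in_itv /= => /andP[x0 x1] <-; move: rt.
  rewrite -ball_normE /= !sub0r !normrN normrM; apply: le_lt_trans.
  rewrite ler_piMl // normc_def /= expr0n addr0 sqrtr_sqr lecR ger0_norm //.
apply: bigcup_connected.
  exists 0 => t _; exists 0; last by rewrite mul0r.
  by rewrite /= in_itv /= lexx ler01.
move=> t _; apply: connected_continuous_connected; first exact: segment_connected.
by apply: continuous_subspaceT; exact: continuous_real_complex.
Qed.

Lemma derivable_quadratic (a b c : C) (t : C) :
  derivable (fun s : C^o => a + b * s + c * s ^+ 2 : C^o) t 1.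
Proof.
have -> : (fun s : C^o => a + b * s + c * s ^+ 2 : C^o) =
    cst a + cst b * id + cst c * (id * id) by apply/funext.
apply: derivableD; first apply: derivableD.
- exact: derivable_cst.
- by apply: derivableM; [exact: derivable_cst|exact: derivable_id].
apply: derivableM; first exact: derivable_cst.
by apply: derivableM; exact: derivable_id.
Qed.
End Topology.

(** * The family over a disc and the theorem *)

Lemma period_line_family (R : realType) d b c (r : R[i]) :
    d = b ^+ 2 + c ^+ 2 -> ~ rat_square d -> 0 < r ->
  line_family (ball (0 : (R[i] : numFieldType)) r) (@period d b c R[i]).
Proof.
move=> dbc dN r0; split.
- exact: ball_open.
- by exists 0; apply: ballxx.
- exact: connected_ball0 r0.
- by move=> t _; apply: period_neq0.
- move=> t _ i; set B := conic d b R[i] *m eigvec d b c R[i].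
  suff -> : (fun s : R[i]^o => period d b c s 0 i : R[i]^o) =
      (fun s => B 0 i + B 1 i * s + B 2 i * s ^+ 2).
    exact: derivable_quadratic.
  apply/funext => s; rewrite /period -/B [LHS]mxE !big_ord_recl big_ord0 .
  have -> : lift ord0 ord0 = 1 :> 'I_3 by apply: val_inj.
  have -> : lift ord0 (lift ord0 ord0) = 2 :> 'I_3 by apply: val_inj.
  rewrite ![powers _ _ _]mxE /= expr0 mul1r addr0 addrA (mulrC (s ^+ 1)).
  by rewrite (mulrC (s ^+ 2)).
- by move=> s t _ _; apply: period_inj.
Qed.

Lemma real_mult_family (R : realType) (d : rat) :
    ~ rat_square d -> rat_sum_two_squares d ->
    exists (U Z : set R[i]) (omega : R[i] -> 'rV[R[i]]_6)
           (T : R[i] -> hodge2 R[i] 6),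
      [/\ line_family U omega, countable Z,
          (forall t, U t -> (H20 (T t) == omega t)%MS /\
                            polarization (T t) form24 /\ K3_type (T t))
        & forall t, U t -> ~ Z t ->
            real_mult_by (Qsqrt d) (T t) form24].
Proof.
move=> dN [b [c dbc]].
pose kap : R[i] := (sqrtC (ratr d) - ratr b) / 2.
have kap0 : 0 < kap by apply: kap_gt0 dbc dN _.
(* The radius of the circle [kap |t|^2 = 1], on which the hermitian form of the period vanishes. *)
pose r : R[i] := sqrtC kap^-1.
have r0 : 0 < r by rewrite sqrtC_gt0 invr_gt0.
have rP (t : R[i]) : ball (0 : (R[i] : numFieldType)) r t -> kap * `|t| ^+ 2 < 1.
  rewrite -ball_normE /= sub0r normrN => tr.
  rewrite mulrC -ltr_pdivlMr // div1r -[kap^-1]sqrtCK -/r.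
  by rewrite ltr_pXn2r // ?nnegrE ?normr_ge0 ?ltW.
have exT (t : R[i]) : exists T : hodge2 R[i] 6, ball (0 : (R[i] : numFieldType)) r t ->
    [/\ (H20 T == period d b c t)%MS, polarization T form24 & K3_type T].
  have TP u (ur : ball (0 : (R[i] : numFieldType)) r u) := period_hodge (period_iso dbc u) (period_pos dbc dN (rP _ ur)).
  (* [T] has to be total: outside the disc it takes the structure at the centre as a default. *)
  have [tr|tr] := pselect (ball (0 : (R[i] : numFieldType)) r t); last by exists (TP 0 (ballxx _ r0)).
  exists (period_hodge (period_iso dbc t) (period_pos dbc dN (rP _ tr))) => _.
  split; [exact: period_H20|exact: period_polarization|exact: period_K3].
have [T TP] := choice exT.
exists (ball (0 : (R[i] : numFieldType)) r), (@exceptional d b c R[i]), (@period d b c R[i]), T; split.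
- exact: period_line_family.
- exact: exceptional_countable.
- by move=> t /TP[].
move=> t /TP[H20t pol K3] tZ.
have [D DE] : exists D : 'M[R[i]]_(6, 1), H20 (T t) = D *m period d b c t.
  by apply/submxP; case/andP: H20t.
apply: (@quad_real_mult_by _ _ _ _ (sqrt_endo d b c)) => //.
- exact: d_gt0 dbc dN.
- apply: (@hodge_endo_self_adjoint _ _ _ _ _ (sqrtC (ratr d)) pol).
    exact: sqrt_endo_adj.
  by rewrite DE -mulmxA (period_eig dbc); exact: esym (scalemxAr _ _ _).
- exact: sqrt_endo_sqr dbc dN.
(* A Hodge endomorphism preserves the line [H20], so the period is an eigenvector of [M]; for [M]
   outside [Q + Q sqrt_endo] this makes [t] exceptional. *)
move=> M /forallP /(_ 2) M20; apply: contrapT => Mbad; apply: tZ.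
exists M => //; apply/sub_rVP; case/andP: H20t => sub1 sub2.
exact: submx_trans (submxMr _ sub2) (submx_trans M20 sub1).
Qed.

(** In (i), [is_field] yields the dichotomy for the adjoint of [sqrt d], and the assumption on [- d]
    rules out the skew-adjoint case. In (ii), [Z] contains all parameters at which further
    endomorphisms occur. *)
Theorem theoremA3 (R : realType) (d : rat) (d_nonsquare : ~ rat_square d) :
  (~ rat_square (- d) -> ~ rat_sum_two_squares d ->
    ~ exists (T : hodge2 R[i] 6) (S : 'M[rat]_6),
        [/\ polarization T S, eq_mod_squares (\det S) 1,
            is_field (hodge_End T) & End_contains (Qsqrt d) T])
  /\
  (rat_sum_two_squares d ->
    exists (U Z : set R[i]) (omega : R[i] -> 'rV[R[i]]_6)
           (T : R[i] -> hodge2 R[i] 6),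
      [/\ line_family U omega, countable Z,
          (forall t, U t -> (H20 (T t) == omega t)%MS /\
                            polarization (T t) form24 /\ K3_type (T t))
        & forall t, U t -> ~ Z t ->
            real_mult_by (Qsqrt d) (T t) form24]).
Proof.
split; last exact: real_mult_family.
move=> Nd dNsum [T [S [pol S1 Efield Kin]]].
by case: (no_hodge_sqrt_mult d_nonsquare pol S1 Efield Kin).
Qed.
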